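(* Let $1<p,q<\infty$ with $\frac1p+\frac1q=1$. Let $T\in\mathbb{L}(\ell^2_p)$ be given by a $2\times 2$ complex matrix, and let $T^t$ be its transpose, regarded as an operator $T^t\in\mathbb{L}(\ell^2_q)$. Then $V(T)=V(T^t)$, where $V(T)$ is the numerical range computed in $\ell^2_p$ and $V(T^t)$ is the numerical range computed in $\ell^2_q$.
   Context: For $1<r<\infty$, $\ell^2_r$ denotes the complex vector space $\mathbb{C}^2$ with norm $\|x\|_r=(|x_1|^r+|x_2|^r)^{1/r}$, and $\mathbb{L}(\ell^2_r)$ is the space of (bounded) linear operators on it; operators are identified with $2\times 2$ complex matrices acting on column vectors in the standard basis. The unique semi-inner-product compatible with the norm is $[x,y]_r=\dfrac{\sum_{k} x_k\overline{y_k}|y_k|^{r-2}}{\|y\|_r^{r-2}}$ for $y\neq 0$ and $[x,0]_r=0$ (where $\overline{y_k}|y_k|^{r-2}$ is read as $0$ when $y_k=0$). For $S\in\mathbb{L}(\ell^2_r)$ the numerical range is $V(S)=\{[Sx,x]_r : \|x\|_r=1\}\subset\mathbb{C}$. $T^t$ denotes the transpose of the matrix $T$ (without complex conjugation). *)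

(* Defs.v *)
From mathcomp Require Import all_boot all_order all_algebra.
From mathcomp Require Export complex.
From mathcomp Require Import classical_sets reals exp.

Set Implicit Arguments.
Unset Strict Implicit.
Unset Printing Implicit Defensive.

Import GRing.Theory.
Local Open Scope ring_scope.
Local Open Scope complex_scope.
Local Open Scope classical_set_scope.

Section EllR.
Variables (R : realType) (n : nat).
Implicit Types (r : R) (x y : 'cV[R[i]]_n) (S : 'M[R[i]]_n).

Definition lnorm r x : R := (\sum_k Normc.normc (x k 0) `^ r) `^ r^-1.

(* When y k 0 = 0 the k-th summand vanishes because of the factor
   (y k 0)^*, whatever the value of 0 `^ (r - 2). *)
Definition sip r x y : R[i] :=
  if y == 0 then 0
  else (\sum_k x k 0 * ((y k 0)^* * (Normc.normc (y k 0) `^ (r - 2))%:C))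
       / (lnorm r y `^ (r - 2))%:C.

Definition numrange r S : set R[i] :=
  [set z | exists2 x, lnorm r x = 1 & z = sip r (S *m x) x].

End EllR.

(* Main.v *)
Require Import Defs.
From mathcomp Require Import all_boot all_order all_algebra.
From mathcomp Require Import classical_sets reals exp.
From mathcomp Require Import ring lra.

(** If [||x||_p = 1], its dual vector [y_k = (x_k)^* |x_k|^(p-2)] satisfies
    [||y||_q = 1], and the dual of [y] with respect to [q] is [x] again.  Hence
    [[Tx, x]_p] and [[T^t y, y]_q] are the same bilinear expression [y^t T x],
    and the roles of [(p, T)] and [(q, T^t)] can be exchanged. *)

Import Order.TTheory GRing.Theory Num.Theory.

Local Open Scope ring_scope.
Local Open Scope complex_scope.
Local Open Scope classical_set_scope.

Definition dualv {R : realType} {n : nat} (r : R) (x : 'cV[R[i]]_n)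
    : 'cV[R[i]]_n :=
  \col_k ((x k 0)^* * (Normc.normc (x k 0) `^ (r - 2))%:C).

Lemma normc_conj (R : rcfType) (z : R[i]) : Normc.normc z^* = Normc.normc z.
Proof. by case: z => a b; rewrite /Normc.normc /= sqrrN. Qed.

Lemma conj_realC (R : rcfType) (a : R) : ((a%:C)^*)%R = a%:C.
Proof. exact: conjc_real. Qed.

Lemma normc_real_ge0 (R : rcfType) (a : R) : 0 <= a -> Normc.normc a%:C = a.
Proof.
by move=> a0; rewrite /Normc.normc /= expr0n addr0 sqrtr_sqr ger0_norm.
Qed.

Lemma normc_ge0 (R : rcfType) (z : R[i]) : 0 <= Normc.normc z.
Proof. by case: z => a b; rewrite sqrtr_ge0. Qed.

Lemma normc_eq0 (R : rcfType) (z : R[i]) : (Normc.normc z == 0) = (z == 0).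
Proof.
by apply/eqP/eqP => [/Normc.eq0_normc//|->]; rewrite Normc.normc0.
Qed.

Lemma conjugate_exponentE (R : realFieldType) (p q : R) :
  1 < p -> 1 < q -> p^-1 + q^-1 = 1 -> (p - 1) * q = p.
Proof.
move=> p1 q1 pq.
have p0 : p != 0 by lra.
have q0 : q != 0 by lra.
have : p * q * (p^-1 + q^-1) = p * q by rewrite pq mulr1.
have -> : p * q * (p^-1 + q^-1) = q + p by field; apply/andP.
lra.
Qed.

Lemma normc_dualv (R : realType) (n : nat) (r : R) (x : 'cV[R[i]]_n) k :
  1 < r -> Normc.normc (dualv r x k 0) = Normc.normc (x k 0) `^ (r - 1).
Proof.
move=> r1; rewrite mxE Normc.normcM normc_conj normc_real_ge0 ?powR_ge0//.
have [->|x0] := eqVneq (x k 0) 0.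
  by rewrite Normc.normc0 mul0r powR0//; lra.
rewrite -{1}[Normc.normc _]powRr1 ?normc_ge0// -powRD.
  by congr (_ `^ _); ring.
by rewrite normc_eq0 x0 implybT.
Qed.

Lemma lnorm_eq1 (R : realType) (n : nat) (r : R) (x : 'cV[R[i]]_n) :
  1 < r -> (lnorm r x == 1) = (\sum_k Normc.normc (x k 0) `^ r == 1).
Proof.
move=> r1; rewrite /lnorm powR_eq1 invr_eq0.
have -> : (r == 0) = false by apply/eqP; lra.
by rewrite ltNge sumr_ge0 ?orbF// => k _; rewrite powR_ge0.
Qed.

(** The sums agree term by term: [|y_k|^q = |x_k|^((p-1)q) = |x_k|^p]. *)
Lemma lnorm_dualv (R : realType) (n : nat) (p q : R) (x : 'cV[R[i]]_n) :
  1 < p -> 1 < q -> p^-1 + q^-1 = 1 ->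
  lnorm p x = 1 -> lnorm q (dualv p x) = 1.
Proof.
move=> p1 q1 pq /eqP; rewrite lnorm_eq1// => /eqP x1.
apply/eqP; rewrite lnorm_eq1//; apply/eqP; rewrite -[RHS]x1.
apply: eq_bigr => k _.
by rewrite normc_dualv// -powRrM conjugate_exponentE.
Qed.

Lemma dualvK (R : realType) (n : nat) (p q : R) (x : 'cV[R[i]]_n) :
  1 < p -> 1 < q -> p^-1 + q^-1 = 1 -> dualv q (dualv p x) = x.
Proof.
move=> p1 q1 pq; apply/matrixP => k j; rewrite ord1 mxE normc_dualv// mxE.
have [->|x0] := eqVneq (x k 0) 0.
  by rewrite conjC0 mul0r conjC0 mul0r.
(* The moduli collect into one power of [|x_k|] with exponent 0, which is 1. *)
rewrite rmorphM /= conjCK conj_realC -mulrA -rmorphM /= -powRrM -powRD.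
  have -> : p - 2 + (p - 1) * (q - 2) = 0.
    by have := conjugate_exponentE _ _ _ p1 q1 pq; lra.
  by rewrite powRr0 mulr1.
by rewrite normc_eq0 x0 implybT.
Qed.

(** On the unit sphere the denominator of [sip] is 1, and its default branch [y = 0] cannot
    occur. *)
Lemma sip_dualv (R : realType) (n : nat) (r : R) (x y : 'cV[R[i]]_n) :
  1 < r -> lnorm r y = 1 -> sip r x y = ((dualv r y)^T *m x) 0 0.
Proof.
move=> r1 y1; rewrite /sip; case: eqP => [y0|_].
  move/eqP: y1; rewrite lnorm_eq1// y0 big1 ?(eq_sym 0) ?oner_eq0//.
  by move=> k _; rewrite mxE Normc.normc0 powR0//; lra.
rewrite y1 powR1 divr1 mxE; apply: eq_bigr => k _.
by rewrite !mxE mulrC.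
Qed.

Lemma bilinear_trmx (K : comPzRingType) (n : nat) (A : 'M[K]_n) (u v : 'cV[K]_n) :
  (u^T *m (A *m v)) 0 0 = (v^T *m (A^T *m u)) 0 0.
Proof.
(* A [1 x 1] product is its own trace, and the trace is invariant under transposition. *)
by rewrite -[RHS]trace_mx11 -mxtrace_tr !trmx_mul !trmxK mulmxA trace_mx11.
Qed.

Lemma numrange_trmx_sub (R : realType) (n : nat) (p q : R) (T : 'M[R[i]]_n) :
  1 < p -> 1 < q -> p^-1 + q^-1 = 1 -> numrange p T `<=` numrange q T^T.
Proof.
move=> p1 q1 pq _ [x x1 ->].
have y1 : lnorm q (dualv p x) = 1 by exact: lnorm_dualv.
exists (dualv p x); first exact: y1.
rewrite (sip_dualv _ _ _ _ _ p1 x1) (sip_dualv _ _ _ _ _ q1 y1).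
rewrite (dualvK _ _ _ _ _ p1 q1 pq).
exact: bilinear_trmx.
Qed.

Theorem theorem2p11 (R : realType) (p q : R) (T : 'M[R[i]]_2)
    (hp : 1 < p) (hq : 1 < q) (hpq : p^-1 + q^-1 = 1) :
  numrange p T = numrange q T^T.
Proof.
apply/seteqP; split; first exact: numrange_trmx_sub.
(* Writing the right-hand [T] as [T^T^T] makes this the first inclusion for [(q, T^T)]. *)
by rewrite -{2}[T]trmxK; apply: numrange_trmx_sub => //; rewrite addrC.
Qed.
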